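(* Let $\mathcal{T}$ be a tree, $G\leq\mathrm{Aut}(\mathcal{T})$ and $k\in\mathbb{N}$. If $G$ satisfies Property $IP_k$ then $G^{(k)}=\overline{G}$; and if $G^{(k)}=\overline{G}$ then $\overline{G}$ satisfies Property $IP_k$. Here $\overline{G}$ is the closure of $G$ in $\mathrm{Aut}(\mathcal{T})$ and $G^{(k)}$ is the $k$-closure of $G$.
   Context: All trees are locally finite simple graphs; $\mathbb{N}=\{1,2,3,\dots\}$. $\mathrm{Aut}(\mathcal{T})$ carries the topology with basis the sets $\mathscr{U}(x,\mathcal{F})=\{y\in\mathrm{Aut}(\mathcal{T}): y.v=x.v\ \forall v\in\mathcal{F}\}$, $x\in\mathrm{Aut}(\mathcal{T})$, $\mathcal{F}\subseteq V(\mathcal{T})$ finite. $B(v,k)$ is the subtree formed by the closed ball of radius $k$ about the vertex $v$ in the graph metric. For an edge $(v,w)$, the semi-tree $\mathcal{T}_{(v,w)}$ is the connected component containing $w$ of the graph obtained from $\mathcal{T}$ by deleting the edges $(v,w),(w,v)$ (keeping their endpoints). $\mathrm{Fix}_H(Y)$ is the set of $h\in H$ fixing every vertex of $Y$. The $k$-closure of $G$ is the group $G^{(k)}=\{x\in\mathrm{Aut}(\mathcal{T}) : \forall v\in V(\mathcal{T})\ \exists g\in G \text{ with } g|_{B(v,k)}=x|_{B(v,k)}\}$. A group $H\leq\mathrm{Aut}(\mathcal{T})$ satisfies Property $IP_k$ if for every edge $e=(v,w)$ of $\mathcal{T}$, with $F_{k,e}:=\mathrm{Fix}_H(B(v,k)\cap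 B(w,k))$, one has $F_{k,e}=\mathrm{Fix}_{F_{k,e}}(\mathcal{T}_{(v,w)})\,\mathrm{Fix}_{F_{k,e}}(\mathcal{T}_{(w,v)})$. *)

(* Defs.v *)
From HB Require Import structures.
From mathcomp Require Import all_boot.
From mathcomp Require Import boolp classical_sets cardinality.
From mathcomp Require Import topology.

Set Implicit Arguments.
Unset Strict Implicit.
Unset Printing Implicit Defensive.

Local Open Scope classical_set_scope.

(* Locally finite simple trees, possibly infinite.  A walk from x is a list p
   with path adj x p; it ends at last x p and has length size p. *)
Record tree := Tree {
  vert :> eqType;
  adj : rel vert;
  adj_sym : symmetric adj;
  adj_irr : irreflexive adj;
  tree_nonempty : inhabited vert;
  tree_connected : forall x y : vert,
    exists p : seq vert, path adj x p /\ last x p = y;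
  tree_acyclic : forall c : seq vert, 2 < size c -> ~ ucycle adj c;
  tree_locally_finite : forall x : vert, finite_set [set y | adj x y]
}.

Record aut (T : tree) := Aut {
  aut_fun :> T -> T;
  aut_bij : bijective aut_fun;
  aut_adj : forall x y : T, adj (aut_fun x) (aut_fun y) = adj x y
}.

Section AutGroup.
Variable T : tree.
Implicit Types x y z : aut T.

Lemma aut_eq x y : x =1 y -> x = y.
Proof.
case: x y => [f fb fa] [g gb ga] /= /funext fg.
by subst g; congr Aut; apply: Prop_irrelevance.
Qed.

Definition aut_id : aut T := @Aut T id (Bijective (frefl _) (frefl _))
  (fun _ _ => erefl).

Fact aut_comp_adj x y (u v : T) : adj ((x \o y) u) ((x \o y) v) = adj u v.
Proof. by rewrite /= !aut_adj. Qed.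

Definition aut_comp x y : aut T :=
  Aut (bij_comp (aut_bij x) (aut_bij y)) (@aut_comp_adj x y).

Fact aut_inv_subproof x : exists y : aut T, cancel x y /\ cancel y x.
Proof.
case: (aut_bij x) => g xg gx.
have ga u v : adj (g u) (g v) = adj u v by rewrite -(aut_adj x) !gx.
by exists (Aut (Bijective gx xg) ga).
Qed.

Definition aut_inv x : aut T := projT1 (cid (aut_inv_subproof x)).

Lemma aut_invK x : cancel x (aut_inv x).
Proof. exact: (projT2 (cid (aut_inv_subproof x))).1. Qed.

Lemma aut_invKV x : cancel (aut_inv x) x.
Proof. exact: (projT2 (cid (aut_inv_subproof x))).2. Qed.

HB.instance Definition _ := gen_eqMixin (aut T).
HB.instance Definition _ := gen_choiceMixin (aut T).
HB.instance Definition _ := isPointed.Build (aut T) aut_id.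

Fact aut_compA : associative aut_comp. Proof. by move=> x y z; apply: aut_eq. Qed.
Fact aut_comp1x : left_id aut_id aut_comp. Proof. by move=> x; apply: aut_eq. Qed.
Fact aut_compx1 : right_id aut_id aut_comp. Proof. by move=> x; apply: aut_eq. Qed.
Fact aut_compVx : left_inverse aut_id aut_inv aut_comp.
Proof. by move=> x; apply: aut_eq => v; exact: aut_invK. Qed.
Fact aut_compxV : right_inverse aut_id aut_inv aut_comp.
Proof. by move=> x; apply: aut_eq => v; exact: aut_invKV. Qed.

(* The product x * y is the composite "y first, then x". *)
HB.instance Definition _ := isGroup.Build (aut T)
  aut_compA aut_comp1x aut_compx1 aut_compVx aut_compxV.

Definition aut_base (i : aut T * set T) : set (aut T) :=
  [set y | forall v, i.2 v -> y v = i.1 v].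

Definition aut_base_dom : set (aut T * set T) := [set i | finite_set i.2].

Fact aut_base_cover : \bigcup_(i in aut_base_dom) aut_base i = setT.
Proof. by apply/seteqP; split=> // x _; exists (x, set0) => //=; exact: finite_set0. Qed.

Fact aut_base_join i j x : aut_base_dom i -> aut_base_dom j ->
  aut_base i x -> aut_base j x ->
  exists k, [/\ aut_base_dom k, aut_base k x &
               aut_base k `<=` aut_base i `&` aut_base j].
Proof.
move=> fi fj ix jx; exists (x, i.2 `|` j.2); split=> //=.
  by rewrite /aut_base_dom /= finite_setU.
by move=> y /= yx; split=> v Fv; rewrite yx /=;
   [exact: ix | left | exact: jx | right].
Qed.

HB.instance Definition _ := isBaseTopological.Build (aut T)
  aut_base_cover aut_base_join.

End AutGroup.

Section Balls.
Variable T : tree.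
Implicit Types u v w : T.

Definition walk_of_length u v : pred nat := fun n =>
  `[< exists p : seq T, [/\ path (@adj T) u p, last u p = v & size p = n] >].

Fact walk_exists u v : exists n, walk_of_length u v n.
Proof.
by have [p [up pv]] := tree_connected u v; exists (size p); apply/asboolP; exists p.
Qed.

Definition dist u v : nat := ex_minn (walk_exists u v).

Definition ball v (k : nat) : set T := [set u | dist v u <= k].

Definition del_edge v w : rel T := fun x y =>
  adj x y && ~~ ((x == v) && (y == w) || (x == w) && (y == v)).

Definition semitree v w : set T :=
  [set u | exists p : seq T, path (del_edge v w) w p /\ last w p = u].

End Balls.

Definition fixer (T : tree) (H : set (aut T)) (Y : set T) : set (aut T) :=
  [set h | H h /\ forall u, Y u -> h u = u].

Definition kclosure (T : tree) (k : nat) (G : set (aut T)) : set (aut T) :=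
  [set x | forall v : T, exists g : aut T,
     G g /\ forall u, ball v k u -> g u = x u].

Definition property_IP (T : tree) (k : nat) (H : set (aut T)) : Prop :=
  forall v w : T, adj v w ->
  let F := fixer H (ball v k `&` ball w k) in
  F = [set (a * b)%g | a in fixer F (semitree v w) & b in fixer F (semitree w v)].

(* Main.v *)
(** If [x] lies in the k-closure, the elements of [G] agreeing with [x] on the
    k-balls of a finite subtree [S] are built leaf by leaf.  Let [g] work for
    [S], let [w] be a new leaf attached at [v], and let [h] agree with [x] on
    the k-ball of [w].  Property IP_k splits [g^-1 * h] as [a * b] along the
    edge (v, w), and [g * b] agrees with [g] on the side of [v] and with [h] on
    the side of [w]; every point of a ball that crosses the edge lies in
    B(v, k) and B(w, k), where [g] and [h] coincide.
    Conversely the k-closure itself satisfies IP_k: cutting [h] along (v, w)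
    leaves on each ball either [h] or the identity, by the same crossing
    property. *)

Require Import Defs.
From mathcomp Require Import all_boot.
From mathcomp Require Import boolp classical_sets cardinality topology.

Set Implicit Arguments.
Unset Strict Implicit.
Unset Printing Implicit Defensive.

Local Open Scope classical_set_scope.

Local Notation ball := Defs.ball.

Section Trees.
Variable T : tree.
Implicit Types (u v w : T) (h : aut T) (G : set (aut T)).

(** * Balls described by walks *)

Lemma ballP v k u : ball v k u <->
  exists p, [/\ path (@adj T) v p, last v p = u & size p <= k].
Proof.
rewrite /ball /= /dist; case: ex_minnP => m /asboolP[p [vp pu <-]] min; split.
  by move=> pk; exists p.
by case=> q [vq qu qk]; apply: leq_trans qk; apply: min; apply/asboolP; exists q.
Qed.

Lemma ball_center v k : ball v k v.
Proof. by apply/ballP; exists [::]. Qed.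

Lemma ball_adj v w k : 0 < k -> adj v w -> ball v k w.
Proof. by move=> k0 vw; apply/ballP; exists [:: w]; rewrite /= vw. Qed.

Lemma ball_aut h v k u : ball v k u -> ball (h v) k (h u).
Proof.
case/ballP => p [vp <- pk]; apply/ballP; exists (map h p).
rewrite size_map last_map; split=> //.
by apply: homo_path vp => a b; rewrite aut_adj.
Qed.

Lemma finite_ball v k : finite_set (ball v k).
Proof.
elim: k v => [|k IHk] v.
  apply: sub_finite_set (finite_set1 v) => u /ballP[[|? ?] [_ /= <-]] //.
apply: (@sub_finite_set _ _
  ([set v] `|` \bigcup_(y in [set y | adj v y]) ball y k)).
  move=> u /ballP[[|y p] [/= ]]; first by move=> _ <- _; left.
  by case/andP=> vy yp pu pk; right; exists y => //; apply/ballP; exists p.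
rewrite finite_setU; split; first exact: finite_set1.
by apply: bigcup_finite => [|y _]; [exact: tree_locally_finite | exact: IHk].
Qed.

(** * The two semi-trees of an edge *)

Lemma del_edgeC v w : del_edge v w =2 del_edge w v.
Proof. by move=> x y; rewrite /del_edge orbC. Qed.

Lemma del_edge_sym v w : symmetric (del_edge v w).
Proof.
by move=> x y; rewrite /del_edge adj_sym orbC (andbC (x == v)) (andbC (x == w)).
Qed.

Lemma semitree_root v w : semitree v w w.
Proof. by exists [::]. Qed.

Lemma semitree_step v w x y : del_edge v w x y ->
  semitree v w x -> semitree v w y.
Proof.
move=> xy [p [wp px]]; exists (rcons p y).
by rewrite rcons_path last_rcons wp px.
Qed.

(** Along a walk from [w], each step other than the edge (v, w) keeps the side reached so far, and a
    step over that edge ends at the root of a side. *)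
Lemma semitree_cover v w u : semitree v w u \/ semitree w v u.
Proof.
have [p [wp <-]] := tree_connected w u.
elim/last_ind: p wp => [_|p y IHp]; first by left; exact: semitree_root.
rewrite rcons_path last_rcons => /andP[/IHp side py].
case: (boolP (del_edge v w (last w p) y)) => [e|].
  case: side => s; [left | right]; apply: semitree_step s; first exact: e.
  by rewrite del_edgeC.
rewrite /del_edge py /= negbK => /orP[/andP[_ /eqP->]|/andP[_ /eqP->]].
  by left; exact: semitree_root.
by right; exact: semitree_root.
Qed.

(** A common vertex would give a walk from [w] to [v] avoiding the edge; made duplicate-free and
    closed up by that edge, it is a cycle. *)
Lemma semitree_disjoint v w u : adj v w -> semitree v w u -> ~ semitree w v u.
Proof.
move=> vw wu [q [vq qu]].
have [p [wp pv]] : semitree v w v.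
  suff: forall q, path (del_edge w v) v q -> semitree v w (last v q) ->
    semitree v w v by apply; [exact: vq | rewrite qu].
  elim/last_ind => // r y IHr; rewrite rcons_path last_rcons => /andP[vr ry] sy.
  by apply: IHr => //; apply: semitree_step sy; rewrite del_edge_sym del_edgeC.
case/shortenP: wp pv => p' wp' Up' _ p'v.
(* The walk has at least two steps: none would give [w = v], and a single one would be the deleted
   edge. *)
have szp : 2 < size (w :: p').
  case: p' wp' Up' p'v => [_ _ /= wv|y [|z p'']] //=.
    by move: vw; rewrite wv adj_irr.
  by rewrite andbT /del_edge => /[swap] _ /[swap] ->; rewrite !eqxx orbT andbF.
apply: (tree_acyclic szp); apply/andP; split=> //=.
rewrite rcons_path p'v vw andbT.
by apply: sub_path wp' => x y /andP[].
Qed.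

(** * Walks and balls that cross the edge *)

Lemma semitree_crossing v w x y : adj v w -> adj x y ->
  semitree v w x -> semitree w v y -> x = w /\ y = v.
Proof.
move=> vw xy sx sy; case: (boolP (del_edge v w x y)) => [e|].
  by case: (semitree_disjoint vw (semitree_step e sx)).
rewrite /del_edge xy /= negbK => /orP[|]/andP[/eqP xE /eqP yE] //.
by case: (semitree_disjoint vw _ (semitree_root w v)); rewrite -{2}xE.
Qed.

(** Cut the walk where it first reaches the side of [w]. The strict bound leaves room to put the
    step from [v] to [w] back in front. *)
Lemma walk_crossing v w u p : adj v w -> path (@adj T) u p ->
    semitree w v u -> semitree v w (last u p) ->
  exists q, [/\ path (@adj T) w q, last w q = last u p & size q < size p].
Proof.
move=> vw; elim: p u => [|y p IHp] u /=.
  by move=> _ su /semitree_disjoint-/(_ vw).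
case/andP=> uy yp su sl; case: (semitree_cover v w y) => sy.
  have [yw _] : y = w /\ u = v by apply: semitree_crossing vw _ sy su; rewrite adj_sym.
  by exists p; rewrite -yw.
by have [q [wq ql qp]] := IHp _ yp sy sl; exists q; split=> //; exact: ltnW.
Qed.

Lemma ball_crossing v w u x k : adj v w -> semitree w v u -> semitree v w x ->
  ball u k x -> (ball v k `&` ball w k) x.
Proof.
move=> vw su sx /ballP[p [up px pk]]; rewrite -px in sx *.
have [q [wq <- qp]] := walk_crossing vw up su sx.
split; apply/ballP; [exists (w :: q) | exists q]; split; rewrite //= ?vw //.
  exact: leq_trans pk.
by apply: ltnW; exact: leq_trans pk.
Qed.

(** * Gluing an automorphism to the identity along an edge *)

Lemma aut_inv_fix h v : h v = v -> (h^-1)%g v = v.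
Proof. by move=> hv; rewrite -{1}hv; exact: aut_invK. Qed.

Lemma semitree_aut h v w u : h v = v -> h w = w ->
  semitree v w u -> semitree v w (h u).
Proof.
move=> hv hw [p [wp <-]]; exists (map h p).
split; last by rewrite -[in LHS]hw last_map.
rewrite -[X in path _ X]hw; apply: homo_path wp => x y.
rewrite /del_edge aut_adj => /andP[-> /=]; apply: contra.
have hE z t : h t = t -> (h z == t) = (z == t).
  by move=> ht; rewrite -[in LHS]ht (bij_eq (aut_bij h)).
by rewrite !hE.
Qed.

(** Fixing both ends, [h] preserves the side of [w], so the patched map is bijective; the only
    adjacency between the sides is the edge itself, which [h] fixes. *)
Lemma glue_id v w h : adj v w -> h v = v -> h w = w ->
  exists b : aut T, (forall u, semitree v w u -> b u = h u) /\
                    (forall u, semitree w v u -> b u = u).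
Proof.
move=> vw hv hw; pose f (g : aut T) u := if `[< semitree v w u >] then g u else u.
have fA (g : aut T) u : semitree v w u -> f g u = g u.
  by rewrite /f => su; case: asboolP.
have fB (g : aut T) u : semitree w v u -> f g u = u.
  by rewrite /f => su; case: asboolP => // /semitree_disjoint-/(_ vw).
have fK (g g' : aut T) : cancel g g' -> g v = v -> g w = w -> cancel (f g) (f g').
  move=> gK gv gw u; have [su|su] := semitree_cover v w u.
    by rewrite fA // fA ?gK //; exact: semitree_aut.
  by rewrite !fB // !fB.
have fbij : bijective (f h).
  exists (f (h^-1)%g); apply: fK => //; first exact: aut_invK.
  - exact: aut_invKV.
  - exact: aut_inv_fix.
  - exact: aut_inv_fix.
have cross x y : semitree v w x -> semitree w v y -> adj (h x) y = adj x y.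
  move=> sx sy; apply/idP/idP => xy.
    have [hx yv] := semitree_crossing vw xy (semitree_aut hv hw sx) sy.
    suff -> : x = w by rewrite yv adj_sym.
    by apply: (bij_inj (aut_bij h)); rewrite hx.
  by have [-> ->] := semitree_crossing vw xy sx sy; rewrite hw adj_sym.
have fadj x y : adj (f h x) (f h y) = adj x y.
  have [sx|sx] := semitree_cover v w x; have [sy|sy] := semitree_cover v w y.
  - by rewrite !fA // aut_adj.
  - by rewrite fA // fB // cross.
  - by rewrite fB // fA // adj_sym cross // adj_sym.
  - by rewrite !fB.
by exists (Aut fbij fadj); split=> u su /=; [rewrite fA | rewrite fB].
Qed.

(** * The closure as agreement on finite sets, and the k-closure *)

Lemma closureP G x : closure G x <->
  forall F : set T, finite_set F -> exists g, G g /\ forall u, F u -> g u = x u.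
Proof.
split=> [Gx F finF|Gx B].
  have : nbhs x (aut_base (x, F)).
    apply: open_nbhs_nbhs; split=> //.
    exists [set (x, F)]; first by move=> _ ->.
    by rewrite bigcup_set1.
  by case/Gx => g [Gg gF]; exists g.
rewrite nbhsE => -[O [[D Dfin <-] [[y F] DyF /= xF]]] OB.
have [g [Gg gx]] := Gx F (Dfin _ DyF); exists g; split=> //.
by apply: OB; exists (y, F) => // u Fu /=; rewrite gx // xF.
Qed.

Lemma closure_kclosure G k : closure G `<=` kclosure k G.
Proof. by move=> x /closureP Gx v; exact: Gx (finite_ball v k). Qed.

Lemma set_mulg G x y : group_closed [in G] -> G x -> G y -> G (x * y)%g.
Proof. by move=> /group_closedM/(_ x y); rewrite !inE; apply. Qed.

Lemma set_invg G x : group_closed [in G] -> G x -> G (x^-1)%g.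
Proof. by move=> /group_closedV/(_ x); rewrite !inE; apply. Qed.

Lemma kclosureM k G : group_closed [in G] ->
  forall x y, kclosure k G x -> kclosure k G y -> kclosure k G (x * y)%g.
Proof.
move=> hG x y Gx Gy v.
(* The second ball is centred at [y v], since [y] maps the ball of [v] into it. *)
have [g [Gg gy]] := Gy v; have [f [Gf fx]] := Gx (y v).
exists (f * g)%g; split=> [|u vu]; first exact: set_mulg.
by rewrite /= gy // fx //; exact: ball_aut.
Qed.

(** * Finite subtrees, grown leaf by leaf *)

Inductive subtree : seq T -> Prop :=
| subtree1 v : subtree [:: v]
| subtree_leaf v w S : subtree S -> v \in S -> w \notin S -> adj v w ->
    subtree (w :: S).

Lemma subtree_ind_adj S (P : set T) v : subtree S ->
    (forall x y, x \in S -> y \in S -> adj x y -> P x -> P y) ->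
  v \in S -> P v -> forall s, s \in S -> P s.
Proof.
move=> tS; elim: tS v => [x|x y {}S _ IHS xS yS xy] v step.
  by rewrite inE => /eqP-> Px s; rewrite inE => /eqP->.
move=> vS Pv.
(* If the start is the new leaf [y], one step to its neighbour [x] brings [P] into the smaller
   subtree. *)
have Px : exists2 z, z \in S & P z.
  move: vS; rewrite inE => /predU1P[vy|vS]; last by exists v.
  exists x => //; apply: step Pv; rewrite ?vy ?mem_head ?inE ?xS ?orbT //.
  by rewrite adj_sym.
have {Px} PS : forall s, s \in S -> P s.
  case: Px => z zS Pz; apply: IHS Pz => // a b aS bS.
  by apply: step; rewrite inE ?aS ?bS orbT.
move=> s; rewrite inE => /predU1P[->|/PS//].
by apply: step xy (PS _ xS); rewrite inE ?eqxx ?xS ?orbT.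
Qed.

(** As [w] is outside [S], no edge inside [S] is the deleted one, so membership in the semi-tree
    spreads from [v]. *)
Lemma subtree_semitree S v w : subtree S -> v \in S -> w \notin S ->
  forall s, s \in S -> semitree w v s.
Proof.
move=> tS vS wS; apply: (subtree_ind_adj tS _ vS) => [x y xS yS xy|].
  apply: semitree_step; rewrite /del_edge xy /=.
  by case: eqP => [xw|_]; [rewrite -xw xS in wS | case: (y =P w) => [yw|];
    rewrite ?andbF //; rewrite -yw yS in wS].
exact: semitree_root.
Qed.

Lemma subtree_add S u : subtree S ->
  exists S', [/\ subtree S', {subset S <= S'} & u \in S'].
Proof.
move=> tS; have [v vS] : exists v, v \in S.
  by case: tS => [v|v w ? _ _ _ _]; [exists v | exists w]; rewrite mem_head.
have [p [vp <-]] := tree_connected v u.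
elim/last_ind: p vp => [_|p y IHp]; first by exists S; split.
rewrite rcons_path last_rcons => /andP[/IHp[S' [tS' SS' pS']] py].
case: (boolP (y \in S')) => yS'; first by exists S'; split.
exists (y :: S'); split; last by rewrite mem_head.
  exact: subtree_leaf py.
by move=> s /SS' sS'; rewrite inE sS' orbT.
Qed.

Lemma finite_sub_subtree (F : set T) : finite_set F ->
  exists S, subtree S /\ forall u, F u -> u \in S.
Proof.
case/finite_seqP => s ->; elim: s => [|u s [S [tS sS]]].
  by case: (tree_nonempty T) => v; exists [:: v]; split=> //; exact: subtree1.
have [S' [tS' SS' uS']] := subtree_add u tS.
by exists S'; split=> // x; rewrite /= inE => /predU1P[->//|/sS/SS'].
Qed.

(** * From Property IP_k to the closure *)

Lemma kclosure_subtree k G x S : group_closed [in G] -> 0 < k ->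
    property_IP k G -> kclosure k G x -> subtree S ->
  exists g, G g /\ forall s u, s \in S -> ball s k u -> g u = x u.
Proof.
move=> hG k0 IP Gx; elim=> [v|v w {}S tS [g [Gg gx]] vS wS vw].
  have [g [Gg gx]] := Gx v; exists g; split=> // s u.
  by rewrite inE => /eqP->; exact: gx.
have [h [Gh hx]] := Gx w; have wv : adj w v by rewrite adj_sym.
have F : fixer G (ball v k `&` ball w k) (g^-1 * h)%g.
  split=> [|u [vu wu]].
    by apply: set_mulg => //; exact: set_invg.
  by rewrite /= hx // -(gx v) //; exact: aut_invK.
move: F; rewrite (IP v w vw).
case=> a [[Ga _] aw] [b [[Gb bvw] bv]] ab.
have hE : h = (g * a * b)%g by rewrite -mulgA ab mulgA mulgV mul1g.
(* Here [a] is trivial on the side of [w], and [b] preserves that side because it fixes [v] and [w];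
   [0 < k] puts both ends in both balls. *)
have bE u : semitree v w u -> (g * b)%g u = h u.
  move=> su; rewrite hE /= aw //; apply: semitree_aut su; apply: bvw; split.
  - exact: ball_center.
  - exact: ball_adj.
  - exact: ball_adj.
  - exact: ball_center.
exists (g * b)%g; split; first exact: set_mulg.
move=> s u; rewrite inE => /predU1P[->|sS] su.
  (* A point of the ball of [w] beyond the edge lies in B(v, k), where [g] already agrees with
     [x]. *)
  have [wu|vu] := semitree_cover v w u; first by rewrite bE // hx.
  rewrite /= bv // (gx v) //.
  by have [] := ball_crossing wv (semitree_root _ _) vu su.
have [wu|vu] := semitree_cover v w u; last by rewrite /= bv // (gx s).
rewrite bE // hx //.
by have [] := ball_crossing vw (subtree_semitree tS vS wS sS) wu su.
Qed.

(** * Property IP_k for the k-closure *)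

Lemma kclosure_split k G v w h : group_closed [in G] -> 0 < k -> adj v w ->
    fixer (kclosure k G) (ball v k `&` ball w k) h ->
  exists b, fixer (fixer (kclosure k G) (ball v k `&` ball w k)) (semitree w v) b
         /\ forall u, semitree v w u -> b u = h u.
Proof.
move=> [G1 _] k0 vw [Gh hfix]; have wv : adj w v by rewrite adj_sym.
have hv : h v = v by apply: hfix; split; [exact: ball_center | exact: ball_adj].
have hw : h w = w by apply: hfix; split; [exact: ball_adj | exact: ball_center].
have [b [bh b1]] := glue_id vw hv hw; exists b; split=> //; split=> //.
split=> [u|u vwu]; last by case: (semitree_cover v w u) => su;
  [rewrite bh // hfix | rewrite b1].
have [su|su] := semitree_cover v w u.
  (* The element of [G] matching [h] near [u] also matches [b]: ball points past the edge lie where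
     [h] is trivial. *)
  have [g [Gg gh]] := Gh u; exists g; split=> // x ux; rewrite gh //.
  have [sx|sx] := semitree_cover v w x; first by rewrite bh.
  by rewrite b1 // hfix // setIC; exact: ball_crossing ux.
exists 1%g; split=> [|x ux]; first by rewrite inE in G1.
have [sx|sx] := semitree_cover v w x; last by rewrite b1.
by rewrite bh // hfix //; exact: ball_crossing ux.
Qed.

Lemma kclosure_IP k G : group_closed [in G] -> 0 < k ->
  property_IP k (kclosure k G).
Proof.
move=> hG k0 v w vw /=; have wv : adj w v by rewrite adj_sym.
apply/seteqP; split=> [h Fh|_ [a [[Ga afix] _] [b [[Gb bfix] _] <-]]]; last first.
  by split=> [|u uI]; [exact: kclosureM | rewrite /= bfix // afix].
have [b [Fb bh]] := kclosure_split hG k0 vw Fh.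
(* The reversed edge gives the other factor. *)
rewrite setIC in Fh; have [a [Fa ah]] := kclosure_split hG k0 wv Fh.
rewrite setIC in Fa; exists a => //; exists b => //.
have [[[_ hfix] [_ a1]] [_ b1]] := (Fh, Fa, Fb).
(* On the side of [w], [b] acts as [h] and [a] fixes the image; on the side of [v], [b] is trivial
   and [a] acts as [h]. *)
apply: aut_eq => u /=; have [su|su] := semitree_cover v w u.
  rewrite bh // a1 //; apply: semitree_aut su; apply: hfix; split.
  - exact: ball_adj.
  - exact: ball_center.
  - exact: ball_center.
  - exact: ball_adj.
by rewrite b1 // ah.
Qed.

End Trees.

Theorem theorem5p4 (T : tree) (G : set (aut T)) (k : nat)
    (hG : group_closed [in G]) (hk : (0 < k)%N) :
  (property_IP k G -> kclosure k G = closure G) /\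
  (kclosure k G = closure G -> property_IP k (closure G)).
Proof.
split=> [IP|<-]; last exact: kclosure_IP.
apply/seteqP; split; last exact: closure_kclosure.
move=> x Gx; apply/closureP => F /finite_sub_subtree[S [tS FS]].
have [g [Gg gx]] := kclosure_subtree hG hk IP Gx tS.
by exists g; split=> // u /FS uS; apply: gx uS _; exact: ball_center.
Qed.
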